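(* (1) If $G$ is a finite non-abelian group isomorphic to one of the groups $D_{2n}$, $T_{4n}$, $SD_{8n}$, $U_{(n,m)}$, $U_{6n}$, $V_{8n}$ or $G(p,m,n)$ ($m,n\ge 1$ integers, $p$ a prime), then the commuting conjugacy class graph $\Gamma(G)$ is CN-integral. (2) If $G$ is a finite non-abelian group and $G/Z(G)$ is isomorphic to $Z_p\times Z_p$ for a prime $p$, or to $D_{2n}$, then $\Gamma(G)$ is CN-integral. (3) If $G$ is a finite non-abelian group and $G/Z(G)$ is of order $p^3$ for a prime $p$, then $\Gamma(G)$ is CN-integral.
   Context: The groups are: $D_{2n}=\langle x,y : x^{n}=y^2=1,\ yxy^{-1}=x^{-1}\rangle$ (dihedral group of order $2n$); $T_{4n}=\langle x,y : x^{2n}=1,\ x^n=y^2,\ y^{-1}xy=x^{-1}\rangle$; $SD_{8n}=\langle x,y : x^{4n}=y^2=1,\ yxy=x^{2n-1}\rangle$; $U_{(n,m)}=\langle x,y : x^{2n}=y^m=1,\ x^{-1}yx=y^{-1}\rangle$; $U_{6n}=U_{(n,3)}$; $V_{8n}=\langle x,y : x^{2n}=y^4=1,\ yx=x^{-1}y^{-1},\ y^{-1}x=x^{-1}y\rangle$; $G(p,m,n)=\langle x,y : x^{p^m}=y^{p^n}=[x,y]^p=1,\ [x,[x,y]]=[y,[x,y]]=1\rangle$, where $[x,y]$ is the commutator. $Z_p$ is the cyclic group of order $p$ and $Z(G)$ is the centre of $G$. For a finite non-abelian group $G$, the commuting conjugacy class graph $\Gamma(G)$ is the simple undirected graph whose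 vertices are the conjugacy classes of the non-central elements of $G$; two distinct vertices $a^G$ and $b^G$ are adjacent if there exist $a'\in a^G$, $b'\in b^G$ with $a'b'=b'a'$. For a finite simple graph $\mathcal{G}$ with vertices $v_1,\dots,v_N$, the common neighbourhood matrix $CN(\mathcal{G})$ is the $N\times N$ matrix whose $(i,j)$ entry is, for $i\ne j$, the number of vertices other than $v_i,v_j$ adjacent to both $v_i$ and $v_j$, and is $0$ for $i=j$. The graph $\mathcal{G}$ is CN-integral if all eigenvalues of $CN(\mathcal{G})$ are integers. *)

(* Defs.v *)
From HB Require Import structures.
From mathcomp Require Import all_boot all_order all_fingroup all_algebra.
From mathcomp Require Import all_solvable all_field.

Set Implicit Arguments.
Unset Strict Implicit.
Unset Printing Implicit Defensive.

Local Open Scope group_scope.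

(* For positive parameters each presentation below defines a finite group, so  *)
(* [G \isog Grp (...)] is isomorphism of G with the presented group.  For      *)
(* n = 0 this would fail; the positivity hypotheses are kept in the statements *)
(* that use these predicates.                                                  *)
Section Presentations.

Variable gT : finGroupType.
Implicit Type G : {set gT}.

Definition is_D2n (n : nat) G : Prop :=
  G \isog Grp (x : y : x ^+ n = y ^+ 2 = 1, y * x * y^-1 = x^-1).

Definition is_T4n (n : nat) G : Prop :=
  G \isog Grp (x : y :
    x ^+ (2 * n) = 1, x ^+ n = y ^+ 2, y^-1 * x * y = x^-1).

Definition is_SD8n (n : nat) G : Prop :=
  G \isog Grp (x : y :
    x ^+ (4 * n) = y ^+ 2 = 1, y * x * y = x ^+ (2 * n - 1)).

Definition is_Unm (n m : nat) G : Prop :=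
  G \isog Grp (x : y : x ^+ (2 * n) = y ^+ m = 1, x^-1 * y * x = y^-1).

Definition is_U6n (n : nat) G : Prop := is_Unm n 3 G.

Definition is_V8n (n : nat) G : Prop :=
  G \isog Grp (x : y :
    x ^+ (2 * n) = y ^+ 4 = 1, y * x = x^-1 * y^-1, y^-1 * x = x^-1 * y).

(* MathComp's commutator is [~ x, y] = x^-1 * y^-1 * x * y; with the other     *)
(* usual convention the presentation defines an isomorphic group.              *)
Definition is_Gpmn (p m n : nat) G : Prop :=
  G \isog Grp (x : y :
    x ^+ (p ^ m) = y ^+ (p ^ n) = 1, [~ x, y] ^+ p = 1,
    [~ x, [~ x, y]] = [~ y, [~ x, y]] = 1).

End Presentations.

Section CommutingConjugacyClassGraph.

Variables (gT : finGroupType) (G : {group gT}).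

Definition noncentral_classes : {set {set gT}} :=
  [set x ^: G | x in G :\: 'Z(G)].

Definition ccc_vertex : finType := {C : {set gT} | C \in noncentral_classes}.

Definition ccc_adj : rel ccc_vertex := fun C D =>
  (C != D) && [exists a in val C, exists b in val D, a * b == b * a].

Lemma ccc_adj_irr : irreflexive ccc_adj.
Proof. by move=> C; rewrite /ccc_adj eqxx. Qed.

Lemma ccc_adj_sym : symmetric ccc_adj.
Proof.
move=> C D; rewrite /ccc_adj eq_sym; congr (_ && _).
by apply/exists_inP/exists_inP => -[a aC /exists_inP[b bD /eqP ab]];
   exists b => //; apply/exists_inP; exists a => //; apply/eqP.
Qed.

End CommutingConjugacyClassGraph.

Section CommonNeighbourhood.

Local Open Scope ring_scope.

Variables (V : finType) (e : rel V).

Definition common_nbrs (u v : V) : {set V} :=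
  [set w | [&& w != u, w != v, e u w & e v w]].

(* Vertices are numbered by the library enumeration of V.                      *)
Definition CN_matrix (R : pzSemiRingType) : 'M[R]_#|V| :=
  \matrix_(i, j)
    if i == j then 0 else #|common_nbrs (enum_val i) (enum_val j)|%:R.

(* The eigenvalues of an integer matrix are algebraic, so no complex           *)
(* eigenvalue is missed by looking in algC.                                    *)
Definition CN_integral : Prop :=
  forall a : algC, eigenvalue (CN_matrix algC) a -> a \is a Num.int.

End CommonNeighbourhood.

(* Main.v *)
Require Import Defs.
From mathcomp Require Import all_boot all_order all_fingroup all_algebra.
From mathcomp Require Import all_solvable all_field.
From mathcomp Require Import zify.

(** All the groups in question have the property that the centralizer of every
    non-central element is abelian ([abelian_centralizers]).  In such a group
    commuting is a transitive relation on non-central elements, and conjugating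
    representatives into place shows that adjacency of classes is transitive as
    well.  So the commuting conjugacy class graph is a disjoint union of
    complete graphs ([ccc_CN_integral]).

    On a clique with [k] vertices the common neighbourhood matrix is
    [(k - 2) (J - I)], with [J] the all-ones matrix, and there is no entry
    between distinct cliques; the eigenvalues are therefore among the integers
    [(k - 2) (k - 1)] and [- (k - 2)] ([clique_CN_integral]).

    Abelian centralizers come from one of two sources.

    - A maximal subgroup [A] that is abelian and normal
      ([abelian_centralizers_maximal]).  A non-central element of [A] has
      centralizer [A] by maximality; an element [a] outside [A] satisfies
      [G = <[a]> A], so its centralizer is [<[a]>] times a part of [A] that
      commutes with [a].  For each presented family, and when [G / 'Z(G)] is
      dihedral, [A] is generated by the centre and one of the two generators
      (or a lift of it to [G]), while the other one normalizes [A] and has its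
      [p]-th power in [A] for some prime [p] ([abelian_centralizers_two_gen]).

    - A central quotient of order [p ^ k] with [k <= 3]
      ([abelian_centralizers_pquotient]).  Let [C] be the centralizer of a
      non-central element.  Both inclusions ['Z(G) < 'Z(C)] and [C < G] are
      proper, which leaves at most one factor [p] for the index of ['Z(C)] in
      [C]; so [C / 'Z(C)] is cyclic and [C] is abelian.  This covers
      [Z_p * Z_p] as well as order [p ^ 3]. *)

Set Implicit Arguments.
Unset Strict Implicit.
Unset Printing Implicit Defensive.

Local Open Scope group_scope.

(** * Spectrum of a disjoint union of complete graphs *)

Section CliqueSpectrum.

Import GRing.Theory Num.Theory.
Local Open Scope ring_scope.

Variables (V : finType) (e : rel V).
Hypothesis e_sym : symmetric e.
(* Transitivity must be restricted to distinct ends to be compatible with a    *)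
(* loopless graph.                                                             *)
Hypothesis e_trans :
  forall u v w, e u v -> e v w -> u != w -> e u w.

Definition clique (u : V) : {set V} := [set w | (w == u) || e u w].

Lemma clique_refl u : u \in clique u.
Proof. by rewrite inE eqxx. Qed.

Lemma clique_eq u v : u \in clique v -> clique u = clique v.
Proof.
have sub a b : a \in clique b -> clique a \subset clique b.
  rewrite inE => ab; apply/subsetP=> w; rewrite !inE.
  case: (eqVneq w b) => //= wb.
  case/orP: ab => [/eqP-> | ba]; first by rewrite (negPf wb).
  by case/orP=> [/eqP-> // | aw]; apply: e_trans ba aw _; rewrite eq_sym.
move=> uv; apply/eqP; rewrite eqEsubset !sub //.
by move: uv; rewrite !inE eq_sym e_sym.
Qed.

Lemma card_common_nbrs u v :
  u != v -> #|common_nbrs e u v| = if e u v then (#|clique v| - 2)%N else 0%N.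
Proof.
move=> uv; case: ifP => [euv | neuv].
  have uC : u \in clique v by rewrite inE e_sym euv orbT.
  rewrite (cardsD1 u (clique v)) uC (cardsD1 v (clique v :\ u)) !inE eqxx.
  rewrite eq_sym uv /= addnA addKn.
  apply: eq_card => w; rewrite !inE.
  case: (eqVneq w u) => [-> | wu] /=; first by rewrite andbF.
  case: (eqVneq w v) => [-> | wv] //=.
  by apply: andb_idl => evw; apply: e_trans euv evw _; rewrite eq_sym.
apply/eqP; rewrite cards_eq0; apply/eqP/setP=> w; rewrite !inE.
apply/and4P=> -[_ _ euw evw]; move: neuv.
by rewrite (@e_trans u w v) // e_sym.
Qed.

(** At a vertex [v] in a clique of size [k], the eigenvector equation reads
    [a f(v) = (k - 2) (S - f(v))] with [S] the sum of [f] over the clique.  Take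
    [v] with [f(v)] nonzero: if [S = 0] then [a = - (k - 2)], and otherwise
    summing over the clique and cancelling [S] gives [a = (k - 2) (k - 1)].  For
    [k = 1] the truncated [k - 2] in [c] is [0] rather than [-1], which is
    harmless since then [S = f(v)]. *)
Theorem clique_CN_integral : CN_integral e.
Proof.
move=> a /eigenvalueP [x /rowP xM nzx].
pose f u := x 0 (enum_rank u).
pose c u : algC := (#|clique u| - 2)%N%:R.
pose S u := \sum_(w in clique u) f w.
have eqS v : a * f v = c v * (S v - f v).
  have := xM (enum_rank v); rewrite !mxE => <-.
  rewrite (reindex (@enum_rank V)) /=; last first.
    by exists enum_val => ? _; rewrite ?enum_rankK ?enum_valK.
  rewrite [S v](bigD1 v) ?clique_refl //= addrAC subrr add0r mulr_sumr.
  rewrite [LHS](bigID (mem (clique v))) /=.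
  rewrite [X in _ + X]big1 ?addr0 => [|u uC]; last first.
    rewrite !mxE (inj_eq enum_rank_inj) !enum_rankK.
    case: eqVneq => [_ | uv]; first by rewrite mulr0.
    rewrite card_common_nbrs //.
    by move: uC; rewrite inE (negPf uv) /= e_sym => /negPf->; rewrite mulr0.
  rewrite (bigD1 v) ?clique_refl //= !mxE eqxx mulr0 add0r.
  apply: eq_bigr => u /andP[uC uv].
  rewrite !mxE (inj_eq enum_rank_inj) !enum_rankK (negPf uv).
  rewrite card_common_nbrs //.
  by move: uC; rewrite inE (negPf uv) /= e_sym => ->; rewrite mulrC.
have [v nzfv] : exists v, f v != 0.
  have [i nzxi] : exists i, x 0 i != 0.
    apply/existsP; apply: contraNT nzx => /existsPn h.
    by apply/eqP/rowP=> i; rewrite mxE; apply/eqP; move: (h i); rewrite negbK.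
  by exists (enum_val i); rewrite /f enum_valK.
have c_int : c v \is a Num.int by rewrite rpred_nat.
have [S0 | nzS] := eqVneq (S v) 0.
  have := eqS v; rewrite S0 sub0r mulrN -mulNr => /(mulIf nzfv) ->.
  by rewrite rpredN.
have : a * S v = (c v * (#|clique v|%:R - 1)) * S v.
  rewrite {1}/S mulr_sumr.
  rewrite (eq_bigr (fun w => c v * (S v - f w))) => [|w wC]; last first.
    by rewrite eqS /c /S (clique_eq wC).
  rewrite -mulr_sumr sumrB sumr_const -/(S v) -mulrA mulrBl mul1r.
  by rewrite -[_ *+ _]mulr_natl.
by move/(mulIf nzS)=> ->; rewrite rpredM // rpredB ?rpred_nat ?rpred1.
Qed.

End CliqueSpectrum.

(** * Groups in which non-central elements have abelian centralizers *)

Section AbelianCentralizers.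

Variables (gT : finGroupType) (G : {group gT}).

Definition abelian_centralizers :=
  forall a, a \in G :\: 'Z(G) -> abelian 'C_G[a].

Lemma noncentral_classP (C : {set gT}) b :
  C \in noncentral_classes G -> b \in C -> b \in G :\: 'Z(G) /\ C = b ^: G.
Proof.
case/imsetP=> x /setDP[Gx nZx] -> bx.
split; last by rewrite (class_eqP bx).
case/imsetP: bx => g Gg ->.
by rewrite inE (groupJ Gx Gg) andbT memJ_norm // (subsetP (gFnorm _ _)).
Qed.

(** If [a] commutes with [b], and a conjugate [b ^ g] commutes with [c], then
    [a] and [c ^ g^-1] both lie in the centralizer of [b], which is abelian. *)
Theorem ccc_CN_integral : abelian_centralizers -> CN_integral (@ccc_adj gT G).
Proof.
move=> CA; apply: clique_CN_integral.
- exact: ccc_adj_sym.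
move=> C D E /andP[_ /exists_inP[a aC /exists_inP[b bD /eqP ab]]].
case/andP=> _ /exists_inP[b' b'D /exists_inP[c cE /eqP b'c]] CE.
rewrite /ccc_adj CE /=.
have [bG defD] := noncentral_classP (valP D) bD.
have [/setDP[Ga _] _] := noncentral_classP (valP C) aC.
have [/setDP[Gc _] defE] := noncentral_classP (valP E) cE.
move: (b'D); rewrite defD => /imsetP[g Gg def_b'].
apply/exists_inP; exists a => //; apply/exists_inP; exists (c ^ g^-1).
  by rewrite defE memJ_class ?groupV.
have cb : c ^ g^-1 \in 'C_G[b].
  rewrite inE groupJ ?groupV //=; apply/cent1P.
  by rewrite -[b](conjgK g) -def_b' /commute -!conjMg b'c.
have ba : a \in 'C_G[b] by rewrite inE Ga; apply/cent1P.
by apply/eqP; apply: (centsP (CA b bG)).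
Qed.

(** Let [a] be non-central.  If [a] lies in [A], its centralizer contains [A] and
    is not [G], so it is [A] by maximality.  Otherwise [G = <[a]> A], and by the
    modular law the centralizer of [a] is [<[a]>] times the centralizer of [a] in
    [A]: two abelian groups that commute with each other. *)
Lemma abelian_centralizers_maximal (A : {group gT}) :
  abelian A -> A <| G -> maximal A G -> abelian_centralizers.
Proof.
move=> cAA nsAG maxA a /setDP[Ga nZa].
have sAG := normal_sub nsAG.
have [Aa | nAa] := boolP (a \in A).
  have sAC : A \subset 'C_G[a].
    by rewrite subsetI sAG sub_cent1 (subsetP cAA).
  have /maximal_eqP[_ maxAP] : maximal_eq A G by rewrite /maximal_eq maxA orbT.
  have [/= -> // | /= defC] := maxAP _ sAC (subsetIl _ _).
  case/negP: nZa; rewrite inE Ga -sub_cent1 /=.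
  by rewrite -{1}defC subsetIr.
have defG : <[a]> * A = G.
  rewrite -(mulg_normal_maximal nsAG maxA (H := <[a]>%G)) ?cycle_subG //.
  by rewrite normC // cycle_subG (subsetP (normal_norm nsAG)).
have -> : 'C_G[a] = <[a]> * 'C_A[a].
  by rewrite -defG -group_modl // cycle_subG cent1id.
rewrite abelianM cycle_abelian (abelianS (subsetIl _ _) cAA) /=.
by rewrite cent_cycle subsetIr.
Qed.

(** Let [C] be the centralizer of the non-central element [a].  In the chain
    ['Z(G) < 'Z(C) <= C < G] the outer inclusions are proper, because of [a], and
    the indices are powers of [p] with product [p ^ k].  Since [k <= 3], the
    middle index divides [p], which makes [C] cyclic modulo its centre, hence
    abelian. *)
Lemma abelian_centralizers_pquotient p k :
  prime p -> k <= 3 -> #|G / 'Z(G)| = (p ^ k)%N -> abelian_centralizers.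
Proof.
move=> p_pr le_k3 oGZ a /setDP[Ga nZa].
pose C := ('C_G[a])%G; pose W := 'Z(C)%G.
have sCG : C \subset G by apply: subsetIl.
have sWC : W \subset C by apply: center_sub.
have sZW : 'Z(G) \subset W.
  have cGZ : G \subset 'C('Z(G)) by rewrite centsC subsetIr.
  rewrite 2!subsetI center_sub sub_cent1 (subsetP cGZ) //= centsC.
  exact: subset_trans sCG cGZ.
have Wa : a \in W.
  by rewrite inE inE Ga cent1id; apply/centP=> c /setIP[_ /cent1P].
apply: (@cyclic_center_factor_abelian _ C).
apply: (dvdn_prime_cyclic p_pr).
rewrite card_quotient ?normal_norm ?center_normal //.
have nCG : #|G : C| != 1%N.
  rewrite indexg_eq1; apply: contra nZa => sGC; rewrite inE Ga -sub_cent1.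
  exact: subset_trans sGC (subsetIr _ _).
have nZW : #|W : 'Z(G)| != 1%N.
  by rewrite indexg_eq1; apply: contra nZa => /subsetP->.
have oG : (#|G : C| * (#|C : W| * #|W : 'Z(G)|))%N = (p ^ k)%N.
  rewrite -oGZ card_quotient ?normal_norm ?center_normal //.
  by rewrite !Lagrange_index // (subset_trans sZW).
have dvd d : d %| #|G : C| * (#|C : W| * #|W : 'Z(G)|) ->
    exists i, d = (p ^ i)%N.
  by rewrite oG => /(dvdn_pfactor _ _ p_pr)[i _ ->]; exists i.
have [i eqi] := dvd _ (dvdn_mulr _ (dvdnn _)).
have [j eqj] := dvd _ (dvdn_mull _ (dvdn_mulr _ (dvdnn _))).
have [l eql] := dvd _ (dvdn_mull _ (dvdn_mull _ (dvdnn _))).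
move: nCG nZW oG; rewrite eqi eqj eql -!expnD.
move=> ni nl /(expnI (prime_gt1 p_pr)) eqk; apply: (@dvdn_exp2l _ _ 1).
by case: i l ni nl eqk {eqi eql} => [|i] [|l] // _ _; lia.
Qed.

(** The quotient [G / A] is generated by the image of [y], so its order divides
    [p]; it is not trivial because [A] is abelian and [G] is not.  Hence [A] is a
    normal subgroup of prime index. *)
Lemma abelian_centralizers_cyclic_ext (A : {group gT}) y p :
    ~~ abelian G -> abelian A -> A \subset G -> y \in G -> y \in 'N(A) ->
    G \subset A <*> <[y]> -> prime p -> y ^+ p \in A ->
  abelian_centralizers.
Proof.
move=> nonG cAA sAG Gy nAy sG p_pr Ayp.
have nAG : G \subset 'N(A).
  by rewrite (subset_trans sG) // join_subG normG cycle_subG.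
have nsAG : A <| G by apply/andP.
apply: (@abelian_centralizers_maximal A) => //.
apply: p_index_maximal => //.
have sGA : G / A \subset <[coset A y]>.
  rewrite -quotient_cycle // -(quotientYidl (G := <[y]>%G)) ?quotientS //.
  by rewrite cycle_subG.
have oy : #[coset A y] %| p.
  by rewrite order_dvdn -morphX //= coset_id //.
have : #|G : A| %| p.
  by rewrite -card_quotient // (dvdn_trans (cardSg sGA)).
move/(prime_nt_dvdP p_pr)=> -> //.
by rewrite indexg_eq1; apply: contra nonG => sGinA; apply: abelianS cAA.
Qed.

(** The abelian subgroup of index [p] is here the one generated by the centre and
    [x].  Adjoining the centre means that the relations between [x] and [y] are
    only needed modulo the centre. *)
Lemma abelian_centralizers_two_gen x y p :
    ~~ abelian G -> prime p -> x \in G -> y \in G ->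
    G \subset 'Z(G) <*> <[x]> <*> <[y]> ->
    x ^ y \in 'Z(G) <*> <[x]> -> y ^+ p \in 'Z(G) <*> <[x]> ->
  abelian_centralizers.
Proof.
move=> nonG p_pr Gx Gy sG Axy Ayp.
have sXG : <[x]> \subset G by rewrite cycle_subG.
have cZX : <[x]> \subset 'C('Z(G)).
  by rewrite centsC (subset_trans (subsetIr _ _)) ?centS.
have cAA : abelian ('Z(G) <*> <[x]>).
  by rewrite abelianY center_abelian cycle_abelian.
apply: (@abelian_centralizers_cyclic_ext ('Z(G) <*> <[x]>)%G y p) => //=.
  by rewrite join_subG center_sub.
rewrite inE -genJ gen_subG conjUg subUset -cycleJ cycle_subG Axy andbT.
rewrite (normP _) ?joing_subl //.
exact: subsetP (normal_norm (center_normal G)) y Gy.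
Qed.

(** Representatives in [G] of [xb] and [yb] satisfy the relations up to the
    centre, which the subgroup generated by the centre and [x] absorbs. *)
Lemma abelian_centralizers_quotient (xb yb : coset_of 'Z(G)) p :
    ~~ abelian G -> prime p -> G / 'Z(G) = <[xb]> <*> <[yb]> ->
    xb ^ yb \in <[xb]> -> yb ^+ p \in <[xb]> ->
  abelian_centralizers.
Proof.
move=> nonG p_pr defGZ.
have nZ := normal_norm (center_normal G).
have Gxb : xb \in G / 'Z(G) by rewrite defGZ -cycle_subG joing_subl.
have Gyb : yb \in G / 'Z(G) by rewrite defGZ -cycle_subG joing_subr.
case/morphimP: Gxb defGZ => x nx Gx -> /=.
case/morphimP: Gyb => y ny Gy -> /= defGZ.
have defX : <[coset 'Z(G) x]> = <[x]> / 'Z(G) by rewrite quotient_cycle.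
have sXN : <[x]> \subset 'N('Z(G)) by rewrite cycle_subG.
have liftX z : z \in G -> coset 'Z(G) z \in <[coset 'Z(G) x]> ->
    z \in 'Z(G) <*> <[x]>.
  move=> Gz zX; have nz := subsetP nZ z Gz.
  rewrite -cycle_subG /= norm_joinEr // -quotientSK ?cycle_subG //.
  by rewrite quotient_cycle // -defX cycle_subG.
rewrite -morphJ // -morphX //= => /liftX Hxy /liftX Hyp.
apply: (@abelian_centralizers_two_gen x y p) => //; last 2 first.
- by apply: Hxy; rewrite groupJ.
- by apply: Hyp; rewrite groupX.
rewrite -joingA norm_joinEr ?join_subG ?sXN ?cycle_subG //.
by rewrite -quotientSK // defGZ quotientY ?cycle_subG // !quotient_cycle.
Qed.

End AbelianCentralizers.

(** * Presented groups and central quotients *)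

Lemma join_cycle_mem (gT : finGroupType) (G : {group gT}) x y :
  <[x]> <*> <[y]> = G -> x \in G /\ y \in G.
Proof.
by move=> <-; rewrite -!cycle_subG joing_subl joing_subr.
Qed.

Lemma center_two_gen (gT : finGroupType) (G : {group gT}) x y z :
  <[x]> <*> <[y]> = G -> z \in G -> commute z x -> commute z y ->
  z \in 'Z(G).
Proof.
move=> defG Gz zx zy; rewrite inE Gz /= -sub_cent1 -defG join_subG !cycle_subG.
by apply/andP; split; apply/cent1P; apply: commute_sym.
Qed.

Lemma D2n_generators (gT : finGroupType) (G : {group gT}) n :
  is_D2n n G ->
  exists x y : gT, [/\ <[x]> <*> <[y]> = G, x ^ y = x^-1 & y ^+ 2 = 1].
Proof.
case/isoGrp_hom/existsP=> -[x y] /= /eqP[defG _ y2 xy].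
exists x, y; split=> //; apply: invg_inj.
by rewrite invgK -conjVg -xy conjgE !mulgA mulVg mul1g mulgKV.
Qed.

Section Presented.

Variables (gT : finGroupType) (G : {group gT}).
Hypothesis nonabelG : ~~ abelian G.

Lemma presented_abelian_centralizers x y p :
    prime p -> <[x]> <*> <[y]> = G ->
    x ^ y \in 'Z(G) <*> <[x]> -> y ^+ p \in 'Z(G) <*> <[x]> ->
  abelian_centralizers G.
Proof.
move=> p_pr defG; have [Gx Gy] := join_cycle_mem defG.
apply: abelian_centralizers_two_gen => //.
by rewrite -joingA defG joing_subr.
Qed.

Let mem_cycle_part x : x \in 'Z(G) <*> <[x]>.
Proof. by rewrite -cycle_subG joing_subr. Qed.

Let mem_center_part x z : z \in 'Z(G) -> z \in 'Z(G) <*> <[x]>.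
Proof. exact: subsetP (joing_subl _ _) z. Qed.

Lemma D2n_abelian_centralizers n : is_D2n n G -> abelian_centralizers G.
Proof.
case/D2n_generators=> x [y [defG xy y2]].
apply: (@presented_abelian_centralizers x y 2) => //; last first.
  by rewrite y2 group1.
by rewrite xy groupV.
Qed.

Lemma T4n_abelian_centralizers n : is_T4n n G -> abelian_centralizers G.
Proof.
case/isoGrp_hom/existsP=> -[x y] /= /eqP[defG _ xn xy].
apply: (@presented_abelian_centralizers x y 2) => //; last first.
  by rewrite -xn groupX.
by rewrite conjgE mulgA xy groupV.
Qed.

Lemma SD8n_abelian_centralizers n : is_SD8n n G -> abelian_centralizers G.
Proof.
case/isoGrp_hom/existsP=> -[x y] /= /eqP[defG _ y2 xy].
apply: (@presented_abelian_centralizers x y 2) => //; last first.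
  by rewrite y2 group1.
have yV : y^-1 = y by apply/eqP; rewrite eq_invg_mul -y2.
by rewrite conjgE yV mulgA xy groupX.
Qed.

(** Here [x] inverts [y], so the generators exchange roles: the abelian subgroup
    is generated by [y] and the centre, and [x ^+ 2] is central. *)
Lemma Unm_abelian_centralizers n m : is_Unm n m G -> abelian_centralizers G.
Proof.
case/isoGrp_hom/existsP=> -[x y] /= /eqP[defG _ _ yx].
have [Gx Gy] := join_cycle_mem defG.
have yJ : y ^ x = y^-1 by rewrite conjgE mulgA.
apply: (@presented_abelian_centralizers y x 2) => //.
- by rewrite joingC.
- by rewrite yJ groupV.
apply: mem_center_part; apply: (center_two_gen defG) => //.
- by rewrite groupX.
- exact/commute_sym/commuteX.
apply/commute_sym/commgP/conjg_fixP.
by rewrite expgS expg1 conjgM yJ conjVg yJ invgK.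
Qed.

(** The two mixed relations express [x^-1] as [y * x * y] and as
    [y^-1 * x * y^-1].  With [y ^+ 4 = 1] this makes [y ^+ 2] central, and modulo
    the centre the second expression says that [y] inverts [x]. *)
Lemma V8n_abelian_centralizers n : is_V8n n G -> abelian_centralizers G.
Proof.
case/isoGrp_hom/existsP=> -[x y] /= /eqP[defG _ y4 yx y'x].
have [Gx Gy] := join_cycle_mem defG.
have xV : x^-1 = y^-1 * x * y^-1 by rewrite y'x mulgK.
have y2V : y ^- 2 = y ^+ 2 by apply/eqP; rewrite eq_invg_mul -expgD y4.
have y2x : commute (y ^+ 2) x.
  rewrite /commute -{2}y2V expgS expg1 -mulgA yx xV invMg !mulgA.
  by rewrite mulgV mul1g.
have Zy2 : y ^+ 2 \in 'Z(G).
  apply: (center_two_gen defG) => //; first by rewrite groupX.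
  exact/commute_sym/commuteX.
apply: (@presented_abelian_centralizers x y 2) => //; last first.
  exact: mem_center_part.
by rewrite conjgE mulgA y'x -mulgA groupM ?groupV // mem_center_part.
Qed.

(** The commutator is central of order dividing [p], so [y ^+ p] commutes with
    [x]: its commutator with [x] is the [p]-th power of [[~ x, y]]. *)
Lemma Gpmn_abelian_centralizers p m n :
  prime p -> is_Gpmn p m n G -> abelian_centralizers G.
Proof.
move=> p_pr /isoGrp_hom/existsP[[x y] /= /eqP[defG _ _ cp xc yc]].
have [Gx Gy] := join_cycle_mem defG.
have cx : commute x [~ x, y] by apply/commgP; rewrite xc.
have cy : commute y [~ x, y] by apply/commgP; rewrite yc.
have Zc : [~ x, y] \in 'Z(G).
  by apply: (center_two_gen defG); rewrite ?groupR.
apply: (@presented_abelian_centralizers x y p) => //.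
  by rewrite conjg_mulR groupM // mem_center_part.
apply: mem_center_part; apply: (center_two_gen defG).
- by rewrite groupX.
- by apply/commute_sym/commgP; rewrite commgX // cp.
exact/commute_sym/commuteX.
Qed.

Lemma D2n_quotient_abelian_centralizers n :
  is_D2n n (G / 'Z(G)) -> abelian_centralizers G.
Proof.
case/D2n_generators=> x [y [defGZ xy y2]].
apply: (@abelian_centralizers_quotient _ _ x y 2) => //.
  by rewrite xy groupV cycle_id.
by rewrite y2 group1.
Qed.

Lemma ZpZp_quotient_abelian_centralizers p :
  prime p -> G / 'Z(G) \isog [set: 'Z_p * 'Z_p] -> abelian_centralizers G.
Proof.
move=> p_pr isoGZ; apply: (@abelian_centralizers_pquotient _ _ p 2) => //.
rewrite (card_isog isoGZ) cardsT card_prod card_ord.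
by rewrite Zp_cast ?prime_gt1 // mulnn.
Qed.

End Presented.

Theorem theorem3p1 (gT : finGroupType) (G : {group gT})
    (nonabelG : ~~ abelian G) :
  [/\ (exists n : nat, (0 < n)%N /\ is_D2n n G) \/
      (exists n : nat, (0 < n)%N /\ is_T4n n G) \/
      (exists n : nat, (0 < n)%N /\ is_SD8n n G) \/
      (exists n m : nat, [/\ (0 < n)%N, (0 < m)%N & is_Unm n m G]) \/
      (exists n : nat, (0 < n)%N /\ is_U6n n G) \/
      (exists n : nat, (0 < n)%N /\ is_V8n n G) \/
      (exists p m n : nat,
         [/\ prime p, (0 < m)%N, (0 < n)%N & is_Gpmn p m n G]) ->
      CN_integral (@ccc_adj gT G),
      (exists p : nat, prime p /\ G / 'Z(G) \isog [set: 'Z_p * 'Z_p]) \/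
      (exists n : nat, (0 < n)%N /\ is_D2n n (G / 'Z(G))) ->
      CN_integral (@ccc_adj gT G)
    & (exists p : nat, prime p /\ #|G / 'Z(G)| = (p ^ 3)%N) ->
      CN_integral (@ccc_adj gT G)].
Proof.
split=> [fam | quo | [p [p_pr oGZ]]]; apply: ccc_CN_integral.
- case: fam => [[n [_ /(D2n_abelian_centralizers nonabelG)]] // |].
  case=> [[n [_ /(T4n_abelian_centralizers nonabelG)]] // |].
  case=> [[n [_ /(SD8n_abelian_centralizers nonabelG)]] // |].
  case=> [[n [m [_ _ /(Unm_abelian_centralizers nonabelG)]]] // |].
  case=> [[n [_ /(Unm_abelian_centralizers nonabelG)]] // |].
  case=> [[n [_ /(V8n_abelian_centralizers nonabelG)]] // |].
  by case=> p [m [n [p_pr _ _ /(Gpmn_abelian_centralizers nonabelG p_pr)]]].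
- case: quo => [[p [p_pr]] | [n [_]]].
    exact: ZpZp_quotient_abelian_centralizers.
  exact: D2n_quotient_abelian_centralizers.
exact: (@abelian_centralizers_pquotient _ _ p 3).
Qed.
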